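(* There is a linear-size translation (a computable map whose output size is bounded by a linear function of the input size) from CoR equations into CoR equations of the form $t=\top$ preserving validity and finite validity (i.e., the input equation is valid iff the output is valid, and finitely valid iff the output is finitely valid), where each output term $t$ lies in the level $\Sigma_2^{\mathrm{CoR}}$ of the dot-dagger alternation hierarchy and contains neither converse $^{\smile}$ nor the identity constant $\mathsf{I}$.
   Context: Fix a countably infinite set $\Sigma$ of term variables. A structure $\mathfrak{A}$ over $\Sigma$ is a non-empty set $|\mathfrak{A}|$ with a binary relation $a^{\mathfrak{A}}\subseteq|\mathfrak{A}|^2$ for each $a\in\Sigma$; it is finite if $|\mathfrak{A}|$ is finite. CoR terms: $t::=a\mid \mathsf{I}\mid t^{-}\mid t\cap s\mid t\cdot s\mid t^{\smile}$ ($a\in\Sigma$), interpreted as binary relations on $|\mathfrak{A}|$: $a^{\mathfrak{A}}$, identity, complement relative to $|\mathfrak{A}|^2$, intersection, composition, converse. Abbreviations: $t\cup s:=(t^-\cap s^-)^-$, $t\dagger s:=(t^-\cdot s^-)^-$, $\top:=\mathsf{I}\cup\mathsf{I}^-$ (the full relation). Size: atoms have size $1$, each operator adds $1$ to the sum of the sizes of its arguments; $\|t=s\|=1+\|t\|+\|s\|$. An equation $t=s$ is valid (resp. finitely valid) if $t$ and $s$ denote the same relation in every structure (resp. every finite structure). Dot-dagger alternation hierarchy: consider terms in which complement is applied only to variables (and to $\mathsf{I}$). $\Sigma_0^{\mathrm{CoR}}=\Pi_0^{\mathrm{CoR}}$ is the set of such terms containing neither $\cdot$ nor $\dagger$; $\Sigma_{n+1}^{\mathrm{CoR}}$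 is the closure of $\Sigma_n^{\mathrm{CoR}}\cup\Pi_n^{\mathrm{CoR}}$ under $\cap,\cup,\cdot$ (and converse); $\Pi_{n+1}^{\mathrm{CoR}}$ is the closure of $\Sigma_n^{\mathrm{CoR}}\cup\Pi_n^{\mathrm{CoR}}$ under $\cap,\cup,\dagger$ (and converse). *)

(* Defs.v *)
From Stdlib Require Import Arith Relations FinFun Cantor.

(** The countably infinite set of term variables is [nat]. *)
Inductive term : Type :=
| Var (a : nat)
| Id
| Neg (t : term)
| Cap (t s : term)
| Dot (t s : term)
| Conv (t : term).

Definition Cup (t s : term) : term := Neg (Cap (Neg t) (Neg s)).
Definition Dagger (t s : term) : term := Neg (Dot (Neg t) (Neg s)).
Definition Top : term := Cup Id (Neg Id).

Record equation : Type := Eqn { lhs : term; rhs : term }.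

(** Abbreviations are counted unfolded, e.g. [Cup t s] has size
    [4 + tsize t + tsize s]. *)
Fixpoint tsize (t : term) : nat :=
  match t with
  | Var _ | Id => 1
  | Neg t | Conv t => 1 + tsize t
  | Cap t s | Dot t s => 1 + (tsize t + tsize s)
  end.

Definition esize (e : equation) : nat := 1 + tsize (lhs e) + tsize (rhs e).

Record structure : Type := Structure {
  carrier : Type;
  carrier_nonempty : inhabited carrier;
  interp : nat -> relation carrier
}.

Fixpoint denote (A : structure) (t : term) (x y : carrier A) : Prop :=
  match t with
  | Var a => interp A a x y
  | Id => x = y
  | Neg t => ~ denote A t x y
  | Cap t s => denote A t x y /\ denote A s x y
  | Dot t s => exists z, denote A t x z /\ denote A s z y
  | Conv t => denote A t y x
  end.

Definition holds (A : structure) (e : equation) : Prop :=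
  forall x y, denote A (lhs e) x y <-> denote A (rhs e) x y.

Definition valid (e : equation) : Prop := forall A, holds A e.

Definition finitely_valid (e : equation) : Prop :=
  forall A, Finite (carrier A) -> holds A e.

(** ** Dot-dagger alternation hierarchy

    Membership is a property of primitive terms: the operators [Cup] and
    [Dagger] of the hierarchy are read through their definitions, so a [Neg]
    that is not applied to a variable or to [Id] can only come from unfolding
    one of them. *)
Inductive level0 : term -> Prop :=
| level0_var a : level0 (Var a)
| level0_negvar a : level0 (Neg (Var a))
| level0_id : level0 Id
| level0_negid : level0 (Neg Id)
| level0_cap t s : level0 t -> level0 s -> level0 (Cap t s)
| level0_cup t s : level0 t -> level0 s -> level0 (Cup t s)
| level0_conv t : level0 t -> level0 (Conv t).

Inductive closure (op : term -> term -> term) (B : term -> Prop) :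
  term -> Prop :=
| closure_base t : B t -> closure op B t
| closure_cap t s : closure op B t -> closure op B s -> closure op B (Cap t s)
| closure_cup t s : closure op B t -> closure op B s -> closure op B (Cup t s)
| closure_op t s : closure op B t -> closure op B s -> closure op B (op t s)
| closure_conv t : closure op B t -> closure op B (Conv t).

Fixpoint SigmaCoR (n : nat) : term -> Prop :=
  match n with
  | 0 => level0
  | S m => closure Dot (fun t => SigmaCoR m t \/ PiCoR m t)
  end
with PiCoR (n : nat) : term -> Prop :=
  match n with
  | 0 => level0
  | S m => closure Dagger (fun t => SigmaCoR m t \/ PiCoR m t)
  end.

Fixpoint converse_free (t : term) : Prop :=
  match t with
  | Var _ | Id => True
  | Neg t => converse_free t
  | Cap t s | Dot t s => converse_free t /\ converse_free s
  | Conv _ => False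
  end.

Fixpoint identity_free (t : term) : Prop :=
  match t with
  | Var _ => True
  | Id => False
  | Neg t | Conv t => identity_free t
  | Cap t s | Dot t s => identity_free t /\ identity_free s
  end.

(** ** Computability

    Partial recursive functions, presented as unary functions on [nat] with
    tuples encoded by the Cantor pairing bijection of the standard library.
    Computability has to be imposed explicitly: in the presence of classical
    choice, a Rocq function need not be computable. *)
Notation "⟨ x , y ⟩" := (Cantor.to_nat (x, y)) (format "⟨ x ,  y ⟩").

Inductive program : Type :=
| PZero
| PSucc
| PLeft
| PRight
| PPair (p q : program)
| PComp (p q : program)
| PRec (p q : program)
| PMin (p : program).

(** [computes p x y]: program [p] halts on input [x] with output [y].
    With [f] and [g] the functions of [p] and [q], [PRec p q] is the [h] with
    [h⟨a, 0⟩ = f a] and [h⟨a, n + 1⟩ = g⟨a, ⟨n, h⟨a, n⟩⟩⟩]; and [PMin p] maps [x]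
    to the least [y] with [f⟨x, y⟩ = 0], being defined only if [f⟨x, m⟩] is
    defined for all [m < y]. *)
Fixpoint computes (p : program) (x y : nat) : Prop :=
  match p with
  | PZero => y = 0
  | PSucc => y = S x
  | PLeft => y = fst (Cantor.of_nat x)
  | PRight => y = snd (Cantor.of_nat x)
  | PPair p q => exists u v, computes p x u /\ computes q x v /\ y = ⟨u, v⟩
  | PComp p q => exists u, computes q x u /\ computes p u y
  | PRec p q =>
      let a := fst (Cantor.of_nat x) in
      (fix rec (n r : nat) : Prop :=
         match n with
         | 0 => computes p a r
         | S m => exists z, rec m z /\ computes q ⟨a, ⟨m, z⟩⟩ r
         end) (snd (Cantor.of_nat x)) y
  | PMin p =>
      computes p ⟨x, y⟩ 0 /\
      forall m, m < y -> exists k, computes p ⟨x, m⟩ (S k)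
  end.

Fixpoint code_term (t : term) : nat :=
  match t with
  | Var a => ⟨0, a⟩
  | Id => ⟨1, 0⟩
  | Neg t => ⟨2, code_term t⟩
  | Cap t s => ⟨3, ⟨code_term t, code_term s⟩⟩
  | Dot t s => ⟨4, ⟨code_term t, code_term s⟩⟩
  | Conv t => ⟨5, code_term t⟩
  end.

Definition code_equation (e : equation) : nat :=
  ⟨code_term (lhs e), code_term (rhs e)⟩.

Definition computable (f : equation -> equation) : Prop :=
  exists p, forall e, computes p (code_equation e) (code_equation (f e)).

(* Main.v *)
Require Import Defs.
From Stdlib Require Import Arith Relations FinFun Cantor.
From Stdlib Require Import Lia List Classical.
From Stdlib Require Import FunctionalExtensionality PropExtensionality.

(** A Tseitin-style translation. Every subterm [u] of the equation, including
    [Id], is named by a fresh variable, and the output term says: "either the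
    two named sides agree here, or some naming condition is violated
    somewhere". Each violation of a condition is the nonemptiness of a
    [Sigma_2] term of constant size. The name [E] of the identity is only
    required to be serial and to satisfy [E x y -> E z y -> E x z], which
    already makes it an equivalence relation, and to be a congruence for the
    names of the variables; so the identity is recovered by a quotient. That
    [u] is the converse of [t] is expressed through [E] by the emptiness of
    [(t . u^-) ∩ E] and [(t^- . u) ∩ E]. *)

(** * Translation *)

Definition var_viol (e u : term) : term :=
  Cup (Cap (Dot e u) (Neg u)) (Cap (Dot u e) (Neg u)).
(** [Cap e (Neg e)] is the empty relation, so the dagger holds at a pair exactly when its first
    point has no [e]-successor, a failure of seriality. The other disjunct refutes
    [E x y -> E z y -> E x z]. *)
Definition eq_viol (e : term) : term :=
  Cup (Dagger (Neg e) (Cap e (Neg e))) (Cap (Dot (Neg e) e) e).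
Definition neg_viol (u t : term) : term :=
  Cup (Cap u t) (Cap (Neg u) (Neg t)).
Definition cap_viol (u t s : term) : term :=
  Cup (Cap u (Cup (Neg t) (Neg s))) (Cap (Neg u) (Cap t s)).
(** The complement of [Dot t s] is pushed inwards to a dagger, so that for variables [t] and [s]
    complements stay on variables and the term is in [PiCoR 1]. *)
Definition dot_viol (u t s : term) : term :=
  Cup (Cap u (Dagger (Neg t) (Neg s))) (Cap (Neg u) (Dot t s)).
Definition conv_viol (e u t : term) : term :=
  Cup (Cap (Dot t (Neg u)) e) (Cap (Dot (Neg t) u) e).

(* Indices of variables do not count in the size, so that the code of a
   subterm can serve as the index of its name. *)
Definition name (t : term) : term := Var (code_term t).

Fixpoint viol (u : term) : term :=
  match u with
  | Var _ => var_viol (name Id) (name u)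
  | Id => eq_viol (name Id)
  | Neg t => Cup (neg_viol (name u) (name t)) (viol t)
  | Cap t s =>
      Cup (cap_viol (name u) (name t) (name s)) (Cup (viol t) (viol s))
  | Dot t s =>
      Cup (dot_viol (name u) (name t) (name s)) (Cup (viol t) (viol s))
  | Conv t => Cup (conv_viol (name Id) (name u) (name t)) (viol t)
  end.

(** Replaces [Top], which contains [Id]. *)
Definition full (e : term) : term := Cup e (Neg e).

Definition agree (e t s d : term) : term :=
  Cup (Cup (Cap t s) (Cap (Neg t) (Neg s))) (Dot (full e) (Dot d (full e))).

(** [viol Id] is always included, because the clauses for variables and converse mention the name of
    [Id] even if [Id] does not occur in the equation. *)
Definition translate (e : equation) : equation :=
  Eqn (agree (name Id) (name (lhs e)) (name (rhs e))
         (Cup (viol Id) (Cup (viol (lhs e)) (viol (rhs e))))) Top.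

(** * Size and shape *)

Lemma tsize_viol (t : term) : tsize (viol t) <= 60 * tsize t.
(* The factor 60 is generous: a clause contributes at most 28 symbols besides its recursive
   parts. *)
Proof. induction t; cbn -[Nat.mul] in *; lia. Qed.

Lemma esize_translate (e : equation) :
  esize (translate e) <= 60 * esize e + 200.
Proof.
  destruct e as [t s]; pose proof (tsize_viol t); pose proof (tsize_viol s).
  unfold esize; cbn -[viol Nat.mul].
  pose proof (tsize_viol Id); cbn -[viol Nat.mul] in *; lia.
Qed.

Lemma Sigma2_Sigma1 (t : term) : SigmaCoR 1 t -> SigmaCoR 2 t.
Proof. now intros; apply closure_base; left. Qed.

Lemma Sigma2_Pi1 (t : term) : PiCoR 1 t -> SigmaCoR 2 t.
Proof. now intros; apply closure_base; right. Qed.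

Lemma Sigma2_level0 (t : term) : level0 t -> SigmaCoR 2 t.
Proof. now intros; apply Sigma2_Sigma1, closure_base; left. Qed.

Lemma Sigma2_Dagger_level0 (t s : term) :
  level0 t -> level0 s -> SigmaCoR 2 (Dagger t s).
Proof.
  intros; apply Sigma2_Pi1, closure_op; apply closure_base; now left.
Qed.

Ltac sigma2 :=
  repeat first
    [ assumption
    | apply Sigma2_level0; solve [repeat constructor]
    | apply Sigma2_Dagger_level0; solve [repeat constructor]
    | apply (closure_cap Dot) | apply (closure_cup Dot)
    | apply (closure_op Dot) ].

Lemma Sigma2_viol (t : term) : SigmaCoR 2 (viol t).
Proof. induction t; cbn [viol]; sigma2. Qed.

Lemma Sigma2_translate (e : equation) : SigmaCoR 2 (lhs (translate e)).
Proof.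
  pose proof (Sigma2_viol Id); pose proof (Sigma2_viol (lhs e));
    pose proof (Sigma2_viol (rhs e)).
  cbn [translate lhs]; unfold agree, full; sigma2.
Qed.

Lemma converse_free_viol (t : term) : converse_free (viol t).
Proof. induction t; cbn in *; tauto. Qed.

Lemma identity_free_viol (t : term) : identity_free (viol t).
Proof. induction t; cbn in *; tauto. Qed.

(** * Semantics *)

Section Semantics.
Variable A : structure.

Lemma denote_Neg (t : term) x y : denote A (Neg t) x y <-> ~ denote A t x y.
Proof. reflexivity. Qed.

Lemma denote_Cap (t s : term) x y :
  denote A (Cap t s) x y <-> denote A t x y /\ denote A s x y.
Proof. reflexivity. Qed.

Lemma denote_Dot (t s : term) x y :
  denote A (Dot t s) x y <-> exists z, denote A t x z /\ denote A s z y.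
Proof. reflexivity. Qed.

Lemma denote_Cup (t s : term) x y :
  denote A (Cup t s) x y <-> denote A t x y \/ denote A s x y.
Proof. cbn; tauto. Qed.

Lemma denote_Dagger (t s : term) x y :
  denote A (Dagger t s) x y <-> forall z, denote A t x z \/ denote A s z y.
Proof.
  cbn; split.
  - intros H z; apply NNPP; intros Hz; apply H; exists z; tauto.
  - intros H [z [Ht Hs]]; destruct (H z); tauto.
Qed.

Lemma denote_full (e : term) x y : denote A (full e) x y.
Proof. unfold full; rewrite denote_Cup; cbn; apply classic. Qed.

Lemma denote_Top x y : denote A Top x y.
Proof. exact (denote_full Id x y). Qed.

Definition empty (t : term) : Prop := forall x y, ~ denote A t x y.

Lemma empty_Cup (t s : term) : empty (Cup t s) <-> empty t /\ empty s.
Proof.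
  unfold empty; setoid_rewrite denote_Cup; firstorder.
Qed.

Lemma empty_neg_viol (u t : term) :
  empty (neg_viol u t) <->
  forall x y, denote A u x y <-> ~ denote A t x y.
Proof.
  unfold neg_viol; rewrite empty_Cup; split.
  - intros [H1 H2] x y; specialize (H1 x y); specialize (H2 x y); cbn in *; tauto.
  - intros H; split; intros x y; specialize (H x y); cbn; tauto.
Qed.

Lemma empty_cap_viol (u t s : term) :
  empty (cap_viol u t s) <->
  forall x y, denote A u x y <-> denote A t x y /\ denote A s x y.
Proof.
  unfold cap_viol; rewrite empty_Cup; split.
  - intros [H1 H2] x y; specialize (H1 x y); specialize (H2 x y).
    rewrite denote_Cap, denote_Cup, !denote_Neg in H1; cbn in H2; tauto.
  - intros H; split; intros x y; specialize (H x y);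
      rewrite denote_Cap, ?denote_Cup; cbn; tauto.
Qed.

Lemma empty_dot_viol (u t s : term) :
  empty (dot_viol u t s) <->
  forall x y, denote A u x y <-> exists z, denote A t x z /\ denote A s z y.
Proof.
  unfold dot_viol; rewrite empty_Cup; split.
  - intros [H1 H2] x y; specialize (H1 x y); specialize (H2 x y).
    rewrite denote_Cap, denote_Dagger in H1; cbn in H1, H2.
    split; intros H; [|apply NNPP; tauto].
    apply NNPP; intros Hn; apply H1; split; [exact H|].
    intros z; apply not_and_or; intros Hz; apply Hn; now exists z.
  - intros H; split; intros x y; specialize (H x y).
    + rewrite denote_Cap, denote_Dagger; cbn; intros [Hu Hd].
      apply H in Hu as [z Hz]; specialize (Hd z); tauto.
    + cbn; tauto.
Qed.

(** Reflexivity of [e] suffices, since both conditions are tested at the diagonal pair of [y] with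
    [x] as the intermediate point. *)
Lemma empty_conv_viol (e u t : term) :
  (forall x, denote A e x x) -> empty (conv_viol e u t) ->
  forall x y, denote A u x y <-> denote A t y x.
Proof.
  intros He; unfold conv_viol; rewrite empty_Cup; intros [H1 H2] x y.
  specialize (H1 y y); specialize (H2 y y); cbn in H1, H2.
  specialize (He y); split; intros H; apply NNPP; intros Hn.
  - apply H2; split; [exists x|]; tauto.
  - apply H1; split; [exists x|]; tauto.
Qed.

(** When [e] is true equality, every violating pair is diagonal, which makes the two tests exact. *)
Lemma empty_conv_viol_eq (e u t : term) :
  (forall x y, denote A e x y <-> x = y) ->
  (forall x y, denote A u x y <-> denote A t y x) -> empty (conv_viol e u t).
Proof.
  intros He Hu; unfold conv_viol; rewrite empty_Cup; split; intros x y; cbn;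
    intros [[z [Ht Hz]] ->%He]; specialize (Hu z y); tauto.
Qed.

Lemma empty_eq_viol (e : term) :
  empty (eq_viol e) <->
  (forall x, exists y, denote A e x y) /\
  (forall x y z, denote A e x y -> denote A e z y -> denote A e x z).
Proof.
  unfold eq_viol; rewrite empty_Cup; split.
  - intros [H1 H2]; split.
    + intros x; apply NNPP; intros Hn; apply (H1 x x).
      apply denote_Dagger; intros z; left; intros Hz; apply Hn; now exists z.
    + intros x y z Hx Hz; apply NNPP; intros Hn; apply (H2 x y).
      split; [now exists z | exact Hx].
  - intros [H1 H2]; split; intros x y.
    + rewrite denote_Dagger; cbn; intros H.
      destruct (H1 x) as [z Hz]; specialize (H z); tauto.
    + cbn; intros [[z [Hn Hz]] Hx]; apply Hn; now apply (H2 x y).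
Qed.

(** A successor [y] of [x], used twice in the second condition, gives [E x x]. Symmetry comes from
    [E y y] and [E x y], and transitivity follows. *)
Lemma empty_eq_viol_equivalence (e : term) :
  empty (eq_viol e) -> equivalence _ (denote A e).
Proof.
  rewrite empty_eq_viol; intros [H1 H2].
  assert (Hr : forall x, denote A e x x).
  { intros x; destruct (H1 x) as [y Hy]; now apply (H2 x y). }
  assert (Hs : forall x y, denote A e x y -> denote A e y x).
  { intros x y Hxy; now apply (H2 y y). }
  split; [exact Hr | | exact Hs].
  intros x y z Hxy Hyz; apply (H2 x y z); [exact Hxy | now apply Hs].
Qed.

Lemma empty_var_viol (e u : term) :
  empty (var_viol e u) <->
  (forall x y z, denote A e x z -> denote A u z y -> denote A u x y) /\
  (forall x y z, denote A u x z -> denote A e z y -> denote A u x y).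
Proof.
  unfold var_viol; rewrite empty_Cup; split.
  - intros [H1 H2]; split; intros x y z Hx Hz; apply NNPP; intros Hn;
      [apply (H1 x y) | apply (H2 x y)]; (split; [now exists z | exact Hn]).
  - intros [H1 H2]; split; intros x y; cbn; intros [[z [Hx Hz]] Hn];
      apply Hn; eauto.
Qed.

(** Composing [d] with the full relation on both sides makes a violation at any one pair count at
    every pair. *)
Lemma denote_agree (e t s d : term) x y :
  denote A (agree e t s d) x y <->
  ((denote A t x y <-> denote A s x y) \/ ~ empty d).
Proof.
  unfold agree; rewrite denote_Cup, denote_Cup, !denote_Cap, !denote_Neg.
  assert (Hd : denote A (Dot (full e) (Dot d (full e))) x y <-> ~ empty d).
  { split.
    - intros (u & _ & v & Hd & _) H; now apply (H u v).
    - intros H; apply NNPP; intros Hn; apply H; intros u v Huv; apply Hn.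
      exists u; split; [apply denote_full|].
      exists v; split; [exact Huv | apply denote_full]. }
  rewrite Hd; tauto.
Qed.

End Semantics.

(** * Soundness: quotient by the name of the identity *)

Lemma quotient_exists {T : Type} (R : relation T) :
  equivalence T R ->
  exists (Q : Type) (cls : T -> Q),
    Surjective cls /\ forall x y, cls x = cls y <-> R x y.
Proof.
  intros [Hr Ht Hs].
  (* Classes are predicates of the form [R x]; extensionality turns related points into equal
     classes. *)
  exists {P : T -> Prop | exists x, P = R x}.
  exists (fun x => exist _ (R x) (ex_intro _ x eq_refl)); split.
  - intros [P [x ->]]; now exists x.
  - intros x y; split.
    + intros H; apply (f_equal (@proj1_sig _ _)) in H; cbn in H.
      rewrite H; apply Hr.
    + intros Hxy; apply eq_sig_hprop; [intros; apply proof_irrelevance|]; cbn.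
      extensionality z; apply propositional_extensionality; split; eauto.
Qed.

Lemma Finite_surjective {T U : Type} (f : T -> U) :
  Surjective f -> Finite T -> Finite U.
Proof.
  intros Hf [l Hl]; exists (map f l); intros u.
  destruct (Hf u) as [x <-]; now apply in_map.
Qed.

Section Quotient.
Variables (A : structure) (Q : Type) (cls : carrier A -> Q).
Hypothesis cls_surj : Surjective cls.
Hypothesis cls_eq : forall x y, cls x = cls y <-> denote A (name Id) x y.

(** The variable [a] is read from its name, not from [interp A a]. Choosing some representatives is
    harmless once the name is a congruence. *)
Definition quotient : structure :=
  Structure Q
    (match carrier_nonempty A with inhabits x => inhabits (cls x) end)
    (fun a p q => exists x y, cls x = p /\ cls y = q /\
                              denote A (name (Var a)) x y).

(** Congruence is imposed only on names of variables; the other names inherit it through the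
    induction. In the case of [Dot], surjectivity lifts the intermediate class to a point. *)
Lemma denote_quotient (t : term) :
  empty A (viol t) -> forall x y,
  denote quotient t (cls x) (cls y) <-> denote A (name t) x y.
Proof.
  assert (Hr : forall x, denote A (name Id) x x).
  { intros x; now apply cls_eq. }
  induction t as [a| |t IHt|t IHt s IHs|t IHt s IHs|t IHt]; cbn [viol].
  - rewrite empty_var_viol; intros [H1 H2] x y; split.
    + intros (x' & y' & Hx & Hy & H).
      symmetry in Hx; apply cls_eq in Hx, Hy; eauto.
    + intros H; now exists x, y.
  - intros _ x y; apply cls_eq.
  - rewrite empty_Cup, empty_neg_viol; intros [H Ht] x y.
    rewrite denote_Neg, (IHt Ht), H; reflexivity.
  - rewrite !empty_Cup, empty_cap_viol; intros (H & Ht & Hs) x y.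
    rewrite denote_Cap, (IHt Ht), (IHs Hs), H; reflexivity.
  - rewrite !empty_Cup, empty_dot_viol; intros (H & Ht & Hs) x y.
    rewrite denote_Dot, H; split.
    + intros [p Hp]; destruct (cls_surj p) as [z <-]; exists z.
      now rewrite (IHt Ht), (IHs Hs) in Hp.
    + intros [z Hz]; exists (cls z); now rewrite (IHt Ht), (IHs Hs).
  - rewrite empty_Cup; intros [H Ht] x y.
    rewrite (empty_conv_viol A _ _ _ Hr H), <- (IHt Ht); reflexivity.
Qed.

End Quotient.

Lemma holds_translate (A : structure) (e : equation) :
  holds A (translate e) <->
  (empty A (Cup (viol Id) (Cup (viol (lhs e)) (viol (rhs e)))) ->
   forall x y, denote A (name (lhs e)) x y <-> denote A (name (rhs e)) x y).
Proof.
  unfold holds, translate; cbn [lhs rhs]; split.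
  - intros H Hd x y; specialize (H x y); rewrite denote_agree in H.
    pose proof (denote_Top A x y); tauto.
  - intros H x y; rewrite denote_agree; specialize (fun Hd => H Hd x y).
    pose proof (denote_Top A x y); tauto.
Qed.

(** If no condition is violated, the names in [A] behave like the terms in the quotient, where [e]
    holds. The finiteness implication lets one argument serve both kinds of validity. *)
Lemma translate_sound (A : structure) (e : equation) :
  (forall B, (Finite (carrier A) -> Finite (carrier B)) -> holds B e) ->
  holds A (translate e).
Proof.
  intros He; apply holds_translate; rewrite !empty_Cup.
  intros (HE & Ht & Hs) x y.
  destruct (quotient_exists _ (empty_eq_viol_equivalence A _ HE))
    as (Q & cls & Hsurj & Heq).
  rewrite <- (denote_quotient A Q cls Hsurj Heq _ Ht).
  rewrite <- (denote_quotient A Q cls Hsurj Heq _ Hs).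
  apply He, (Finite_surjective cls Hsurj).
Qed.

(** * Completeness: interpreting each name by its term *)

Lemma to_nat_eq (a b c d : nat) : ⟨a, b⟩ = ⟨c, d⟩ <-> a = c /\ b = d.
Proof.
  split.
  - intros [= -> ->]%Cantor.to_nat_inj; now split.
  - now intros [-> ->].
Qed.

Lemma code_term_inj (t s : term) : code_term t = code_term s -> t = s.
Proof.
  revert s; induction t; intros []; cbn [code_term]; rewrite ?to_nat_eq;
    intros H; intuition first [discriminate | f_equal; auto].
Qed.

(** Injectivity of the coding makes the term [t] unique; indices that code no term denote the empty
    relation. *)
Definition name_structure (A : structure) : structure :=
  Structure (carrier A) (carrier_nonempty A)
    (fun n x y => exists t, code_term t = n /\ denote A t x y).

Lemma denote_name_structure (A : structure) (t : term) x y :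
  denote (name_structure A) (name t) x y <-> denote A t x y.
Proof.
  cbn; split.
  - now intros (s & ->%code_term_inj & H).
  - intros H; now exists t.
Qed.

Lemma empty_viol_name_structure (A : structure) (t : term) :
  empty (name_structure A) (viol t).
Proof.
  pose proof (denote_name_structure A) as HA.
  induction t as [a| |t IHt|t IHt s IHs|t IHt s IHs|t IHt]; cbn [viol];
    rewrite ?empty_Cup; repeat split; try assumption.
  - apply empty_var_viol; split; intros x y z; rewrite !HA; cbn; congruence.
  - apply empty_eq_viol; split.
    + intros x; exists x; now rewrite HA.
    + intros x y z; rewrite !HA; cbn; congruence.
  - apply empty_neg_viol; intros x y; now rewrite !HA.
  - apply empty_cap_viol; intros x y; now rewrite !HA.
  - apply empty_dot_viol; intros x y; setoid_rewrite HA; reflexivity.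
  - apply empty_conv_viol_eq; intros x y; now rewrite !HA.
Qed.

Lemma translate_complete (A : structure) (e : equation) :
  holds (name_structure A) (translate e) -> holds A e.
Proof.
  rewrite holds_translate; intros H x y.
  rewrite <- (denote_name_structure A (lhs e)),
    <- (denote_name_structure A (rhs e)); apply H.
  rewrite !empty_Cup; auto using empty_viol_name_structure.
Qed.

(** * Computability *)

Definition comp (f : nat -> nat) : Prop :=
  exists p, forall x, computes p x (f x).

Definition left (x : nat) : nat := fst (Cantor.of_nat x).
Definition right (x : nat) : nat := snd (Cantor.of_nat x).

Lemma left_pair (a b : nat) : left ⟨a, b⟩ = a.
Proof. unfold left; now rewrite Cantor.cancel_of_to. Qed.

Lemma right_pair (a b : nat) : right ⟨a, b⟩ = b.
Proof. unfold right; now rewrite Cantor.cancel_of_to. Qed.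

Lemma comp_ext (f g : nat -> nat) : (forall x, f x = g x) -> comp f -> comp g.
Proof. intros H [p Hp]; exists p; intros x; now rewrite <- H. Qed.

Lemma comp_compose (f g : nat -> nat) :
  comp f -> comp g -> comp (fun x => f (g x)).
Proof.
  intros [p Hp] [q Hq]; exists (PComp p q); intros x; cbn; eauto.
Qed.

Lemma comp_pair (f g : nat -> nat) :
  comp f -> comp g -> comp (fun x => ⟨f x, g x⟩).
Proof.
  intros [p Hp] [q Hq]; exists (PPair p q); intros x; cbn -[Cantor.to_nat]; eauto.
Qed.

Lemma comp_left (f : nat -> nat) : comp f -> comp (fun x => left (f x)).
Proof. apply comp_compose; now exists PLeft. Qed.

Lemma comp_right (f : nat -> nat) : comp f -> comp (fun x => right (f x)).
Proof. apply comp_compose; now exists PRight. Qed.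

Lemma comp_id : comp (fun x => x).
Proof.
  (* No primitive is the identity, so the input is split and paired again. *)
  exists (PPair PLeft PRight); intros x; cbn -[Cantor.to_nat Cantor.of_nat].
  do 2 eexists; do 2 (split; [reflexivity|]).
  now rewrite <- surjective_pairing, Cantor.cancel_to_of.
Qed.

Lemma comp_S (f : nat -> nat) : comp f -> comp (fun x => S (f x)).
Proof. apply comp_compose; now exists PSucc. Qed.

Lemma comp_const (n : nat) : comp (fun _ => n).
Proof. induction n; [now exists PZero | now apply comp_S]. Qed.

Create HintDb comp.
#[local] Hint Resolve comp_pair comp_left comp_right comp_id comp_S comp_const
  : comp.

Lemma comp_rec (f g n : nat -> nat) :
  comp f -> comp g -> comp n ->
  comp (fun x => nat_rect (fun _ => nat) (f x) (fun m z => g ⟨x, ⟨m, z⟩⟩) (n x)).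
Proof.
  intros [p Hp] [q Hq] Hn.
  (* [PRec] receives parameter and bound packed into one number; [h] is the recursion in that
     form. *)
  set (h := fun w => nat_rect (fun _ => nat) (f (left w))
    (fun m z => g ⟨left w, ⟨m, z⟩⟩) (right w)).
  apply (comp_ext (fun x => h ⟨x, n x⟩)).
  { intros x; unfold h; now rewrite left_pair, right_pair. }
  apply comp_compose; [unfold h | auto with comp].
  exists (PRec p q); intros w; cbn -[Cantor.to_nat Cantor.of_nat].
  fold (left w) (right w); induction (right w) as [|m IH];
    cbn -[Cantor.to_nat Cantor.of_nat]; eauto.
Qed.

(** The recursion step returns its counter [m], the predecessor of [S m]. *)
Lemma comp_pred (f : nat -> nat) : comp f -> comp (fun x => pred (f x)).
Proof.
  intros Hf.
  apply (comp_ext (fun x => nat_rect (fun _ => nat) 0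
    (fun m z => left (right ⟨x, ⟨m, z⟩⟩)) (f x))).
  - intros x; destruct (f x); cbn -[Cantor.to_nat]; [reflexivity|].
    now rewrite right_pair, left_pair.
  - apply comp_rec with (g := fun w => left (right w)); auto with comp.
Qed.

Lemma comp_sub (f g : nat -> nat) :
  comp f -> comp g -> comp (fun x => f x - g x).
Proof.
  intros Hf Hg.
  apply (comp_ext (fun x => nat_rect (fun _ => nat) (f x)
    (fun m z => pred (right (right ⟨x, ⟨m, z⟩⟩))) (g x))).
  - intros x; induction (g x) as [|m IH]; cbn -[Cantor.to_nat]; [lia|].
    rewrite !right_pair, IH; lia.
  - apply comp_rec with (g := fun w => pred (right (right w)));
      auto using comp_pred with comp.
Qed.

Lemma comp_case (n f g : nat -> nat) :
  comp n -> comp f -> comp g ->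
  comp (fun x => match n x with 0 => f x | S _ => g x end).
Proof.
  intros Hn Hf Hg.
  apply (comp_ext (fun x => nat_rect (fun _ => nat) (f x)
    (fun m z => g (left ⟨x, ⟨m, z⟩⟩)) (n x))).
  - intros x; destruct (n x); cbn -[Cantor.to_nat]; now rewrite ?left_pair.
  - apply comp_rec with (g := fun w => g (left w)); trivial.
    apply (comp_compose g left); auto with comp.
Qed.

(** Capping the index at [N] leaves finitely many cases, so computability of each [F i] separately
    is enough; the cases are nested case distinctions. *)
Lemma comp_switch (N : nat) (F : nat -> nat -> nat) (n : nat -> nat) :
  (forall i, comp (F i)) -> comp n -> comp (fun x => F (Nat.min N (n x)) x).
Proof.
  revert F n; induction N as [|N IH]; intros F n HF Hn; [exact (HF 0)|].
  apply (comp_ext (fun x => match n x with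
    | 0 => F 0 x | S _ => F (S (Nat.min N (pred (n x)))) x end)).
  - intros x; now destruct (n x).
  - apply comp_case; auto.
    apply (IH (fun i => F (S i))); auto using comp_pred.
Qed.

(** * Course-of-values recursion *)

(* [table g n] is the list of the first [n] values of the function defined by
   course-of-values recursion from [g], latest value first. *)
Definition table (g : nat -> nat) (n : nat) : nat :=
  nat_rect (fun _ => nat) 0 (fun m l => ⟨g ⟨m, l⟩, l⟩) n.

Definition cov (g : nat -> nat) (n : nat) : nat := g ⟨n, table g n⟩.

(* The value at [k], given a pair of [n] and a table of length [n > k]. *)
Definition lookup (k w : nat) : nat :=
  left (nat_rect (fun _ => nat) (right w) (fun _ l => right l) (left w - S k)).

Lemma lookup_table (g : nat -> nat) (k n : nat) :
  k < n -> lookup k ⟨n, table g n⟩ = cov g k.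
Proof.
  intros Hk; unfold lookup; rewrite left_pair, right_pair.
  replace (table g n) with (table g (S k + (n - S k))) by (f_equal; lia).
  assert (H : forall d, nat_rect (fun _ => nat) (table g (S k + d))
    (fun _ l => right l) d = table g (S k)).
  { induction d as [|d IH]; [now rewrite Nat.add_0_r|].
    rewrite <- IH, Nat.add_succ_r; clear IH.
    set (m := S k + d); change (table g (S m)) with ⟨cov g m, table g m⟩.
    (* What remains is that dropping [S d] entries from a list with head [c] and tail [l] is
       dropping [d] from [l]. It needs its own induction because [nat_rect] adds each new [right] on
       the outside. *)
    generalize (cov g m), (table g m); intros c l.
    induction d as [|d IH]; cbn -[Cantor.to_nat] in *.
    - apply right_pair.
    - now rewrite IH. }
  rewrite H; apply left_pair.
Qed.

Lemma comp_cov (g : nat -> nat) : comp g -> comp (cov g).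
Proof.
  intros Hg; apply (comp_compose g (fun n => ⟨n, table g n⟩)); [exact Hg|].
  apply comp_pair; [apply comp_id|].
  set (h := fun w => ⟨g (right w), right (right w)⟩).
  apply (comp_ext (fun n => nat_rect (fun _ => nat) 0
    (fun m l => h ⟨n, ⟨m, l⟩⟩) n)).
  (* The parameter passed to [h] is separated from the bound, so that the induction varies only the
     bound. *)
  - intros n; unfold table; generalize n at 1 as a; intros a.
    induction n as [|m IH]; [reflexivity|].
    cbn -[Cantor.to_nat h]; rewrite IH; unfold h; now rewrite !right_pair.
  - apply comp_rec; unfold h; auto using comp_compose with comp.
Qed.

Lemma comp_lookup (k : nat -> nat) :
  comp k -> comp (fun w => lookup (k w) w).
Proof.
  intros Hk; apply comp_left.
  apply (comp_ext (fun w => nat_rect (fun _ => nat) (right w)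
    (fun m l => right (right (right ⟨w, ⟨m, l⟩⟩))) (left w - S (k w)))).
  - intros w; induction (left w - S (k w)) as [|m IH];
      cbn -[Cantor.to_nat]; [reflexivity|].
    now rewrite !right_pair, IH.
  - apply comp_rec with (g := fun v => right (right (right v)));
      auto using comp_sub with comp.
Qed.

(** * Computing the translation on codes *)

(* The code of the term obtained from [t] by replacing each variable [i] with
   the term coded by [r i]. *)
Fixpoint fill (r : nat -> nat) (t : term) : nat :=
  match t with
  | Var i => r i
  | Id => ⟨1, 0⟩
  | Neg t => ⟨2, fill r t⟩
  | Cap t s => ⟨3, ⟨fill r t, fill r s⟩⟩
  | Dot t s => ⟨4, ⟨fill r t, fill r s⟩⟩
  | Conv t => ⟨5, fill r t⟩
  end.

Lemma comp_fill (r : nat -> nat -> nat) (t : term) :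
  (forall i, comp (fun x => r x i)) -> comp (fun x => fill (r x) t).
Proof. intros Hr; induction t; cbn -[Cantor.to_nat]; auto with comp. Qed.

(* One clause of [viol] per tag of [code_term], with placeholders as in
   [viol_env]. *)
Definition viol_clause (tag : nat) : term :=
  match tag with
  | 0 => var_viol (Var 0) (Var 1)
  | 1 => eq_viol (Var 0)
  | 2 => Cup (neg_viol (Var 1) (Var 2)) (Var 3)
  | 3 => Cup (cap_viol (Var 1) (Var 4) (Var 6)) (Cup (Var 5) (Var 7))
  | 4 => Cup (dot_viol (Var 1) (Var 4) (Var 6)) (Cup (Var 5) (Var 7))
  | _ => Cup (conv_viol (Var 0) (Var 1) (Var 2)) (Var 3)
  end.

(** Here [w] pairs a code [n] with the table of earlier values, and [⟨0, n⟩] codes the name of the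
    term coded by [n]. Placeholders 2 and 3 are the name and violation term of a unary argument; 4,
    5 and 6, 7 are those of the two binary arguments. *)
Definition viol_env (w i : nat) : nat :=
  let n := left w in
  let t := right n in
  match i with
  | 0 => code_term (name Id)
  | 1 => ⟨0, n⟩
  | 2 => ⟨0, t⟩
  | 3 => lookup t w
  | 4 => ⟨0, left t⟩
  | 5 => lookup (left t) w
  | 6 => ⟨0, right t⟩
  | _ => lookup (right t) w
  end.

(** Tags above 5 code no term and are treated as 5, which keeps the case distinction finite. *)
Definition viol_code : nat -> nat :=
  cov (fun w => fill (viol_env w) (viol_clause (Nat.min 5 (left (left w))))).

Lemma comp_viol_code : comp viol_code.
Proof.
  apply comp_cov, (comp_switch 5 (fun i w => fill (viol_env w) (viol_clause i)));
    [|auto with comp].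
  intros tag; apply comp_fill; intros i; unfold viol_env.
  do 7 (destruct i as [|i]; [auto 7 using comp_lookup with comp|]).
  auto using comp_lookup with comp.
Qed.

(** Compound terms have positive tags, so codes of arguments are strictly smaller, as [lookup_table]
    requires. *)
Lemma code_lt_unary (tag a : nat) : 0 < tag -> a < ⟨tag, a⟩.
Proof. intros; pose proof (Cantor.to_nat_non_decreasing tag a); lia. Qed.

Lemma code_lt_binary (tag a b : nat) :
  0 < tag -> a < ⟨tag, ⟨a, b⟩⟩ /\ b < ⟨tag, ⟨a, b⟩⟩.
Proof.
  intros; pose proof (Cantor.to_nat_non_decreasing tag ⟨a, b⟩).
  pose proof (Cantor.to_nat_non_decreasing a b); lia.
Qed.

Lemma viol_code_correct (t : term) :
  viol_code (code_term t) = code_term (viol t).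
Proof.
  induction t as [a| |t IHt|t IHt s IHs|t IHt s IHs|t IHt];
    unfold viol_code, cov; fold viol_code; rewrite left_pair;
    set (w := ⟨code_term _, _⟩);
    cbn [code_term]; rewrite left_pair;
    cbn -[Cantor.to_nat left right lookup];
    unfold w; cbn [code_term]; rewrite ?left_pair, ?right_pair, ?left_pair;
    rewrite ?lookup_table by
      (solve [apply code_lt_unary; lia | apply code_lt_binary; lia]);
    fold viol_code; rewrite ?IHt, ?IHs; reflexivity.
Qed.

Lemma computable_translate : computable translate.
Proof.
  (* The placeholders of [agree] are, in order, the name of [Id], the names of the two sides, and
     the three violation terms. *)
  set (r := fun x i => match i with
    | 0 => code_term (name Id)
    | 1 => ⟨0, left x⟩
    | 2 => ⟨0, right x⟩
    | 3 => code_term (viol Id)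
    | 4 => viol_code (left x)
    | _ => viol_code (right x)
    end).
  destruct (comp_pair
    (fun x => fill (r x) (agree (Var 0) (Var 1) (Var 2)
                            (Cup (Var 3) (Cup (Var 4) (Var 5)))))
    (fun _ => code_term Top)) as [p Hp].
  - apply comp_fill; intros i; unfold r.
    do 5 (destruct i as [|i];
      [auto using comp_compose, comp_viol_code with comp|]).
    auto using comp_compose, comp_viol_code with comp.
  - apply comp_const.
  - exists p; intros [t s].
    replace (code_equation (translate (Eqn t s))) with
      ((fun x => ⟨fill (r x) (agree (Var 0) (Var 1) (Var 2)
                            (Cup (Var 3) (Cup (Var 4) (Var 5)))),
                 code_term Top⟩) (code_equation (Eqn t s))); [apply Hp|].
    unfold r, code_equation; cbn [lhs rhs].
    rewrite left_pair, right_pair, !viol_code_correct; reflexivity.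
Qed.

Theorem theorem2 :
  exists f : equation -> equation,
    computable f /\
    (exists c d : nat, forall e : equation, esize (f e) <= c * esize e + d) /\
    (forall e : equation, exists t : term,
        f e = Eqn t Top /\
        SigmaCoR 2 t /\ converse_free t /\ identity_free t) /\
    (forall e : equation, valid e <-> valid (f e)) /\
    (forall e : equation, finitely_valid e <-> finitely_valid (f e)).
Proof.
  exists translate; split; [|split; [|split; [|split]]].
  - exact computable_translate.
  - exists 60, 200; exact esize_translate.
  - intros e; exists (lhs (translate e)); split; [reflexivity|].
    split; [apply Sigma2_translate|].
    pose proof (converse_free_viol (lhs e)); pose proof (converse_free_viol (rhs e)).
    pose proof (identity_free_viol (lhs e)); pose proof (identity_free_viol (rhs e)).
    cbn; tauto.
  - intros e; split.
    + intros He A; apply translate_sound; auto.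
    + intros He A; apply translate_complete, He.
  - intros e; split.
    + intros He A HA; apply translate_sound; auto.
    (* [name_structure A] has the carrier of [A], so [HA] also shows it finite. *)
    + intros He A HA; apply translate_complete, He; exact HA.
Qed.
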